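(* The Kauffman bracket polynomial satisfies the following relations at a triple crossing of a projection. If the triple crossing is a BMT crossing, then $$\langle BMT\rangle = A^{3}\langle S_M\rangle + A\left(\langle U_1\rangle + \langle U_2\rangle\right) + A^{-1}\left(\langle S_B\rangle + \langle S_T\rangle\right),$$ and if the triple crossing is a TMB crossing, then $$\langle TMB\rangle = A^{-3}\langle S_M\rangle + A^{-1}\left(\langle U_1\rangle + \langle U_2\rangle\right) + A\left(\langle S_B\rangle + \langle S_T\rangle\right).$$ Here the left-hand side is the bracket of the diagram containing the given triple crossing, and $S_M, S_B, S_T, U_1, U_2$ denote the diagrams obtained from it by replacing that triple crossing by, respectively, its M-split, B-split, T-split, and its two U-splits, the rest of the diagram being unchanged.
   Context: A triple crossing is a singular point of a knot or link projection at which exactly three strands cross, each passing straight through; the strands are labelled T (top), M (middle), B (bottom). It is a BMT crossing if the labels of the strand ends, read clockwise around the crossing, are B, M, T, B, M, T, and a TMB crossing if, read clockwise, they are T, M, B, T, M, B. The bracket of a projection with triple crossings is the bracket of the double-crossing diagram obtained by perturbing each triple crossing slightly so that it resolves into three double crossings (T over M, T over B, M over B). Kauffman bracket conventions: $\langle\bigcirc\rangle=1$, $\langle D\sqcup\bigcirc\rangle=(-A^2-A^{-2})\langle D\rangle$, and at a double crossing $\langle D\rangle=A\langle D_A\rangle+A^{-1}\langle D_B\rangle$, where $D_A$ is the smoothing that joins the two regions swept out when the overstrand is rotated counterclockwise toward the understrand, and $D_B$ is the other smoothing. Splits of a triple crossing: number the six strand ends $1,\dots,6$ in cyclic order, so that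 the three strands join $i$ to $i+3$. For $X\in\{T,M,B\}$, the $X$-split replaces the crossing by the planar (crossingless) tangle in which strand $X$ goes straight through, and on each side of strand $X$ the two remaining ends on that side are joined to each other by a U-turn arc. The two U-splits are the planar tangles joining adjacent ends in pairs: $\{1,2\},\{3,4\},\{5,6\}$ and $\{2,3\},\{4,5\},\{6,1\}$. *)

(* Defs.v *)
From HB Require Import structures.
From mathcomp Require Import all_boot all_order all_algebra.

Set Implicit Arguments.
Unset Strict Implicit.
Unset Printing Implicit Defensive.

Import GRing.Theory.
Local Open Scope ring_scope.

(** Link projections are given by planar-diagram codes: the edges of the
    projection are labelled by natural numbers, and every site lists the labels
    of its strand ends CLOCKWISE.  Each label occurs exactly twice.
    [Arc x y] is a crossingless piece of strand, so that [[:: Arc x x]] is a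
    circle. *)

(** In [Crossing o u o' u'] the overstrand joins [o] to [o']. *)
Inductive piece :=
  | Arc (x y : nat)
  | Crossing (o u o' u' : nat).

Inductive level := Top | Mid | Bot.

Definition rank (l : level) : nat :=
  match l with Top => 2 | Mid => 1 | Bot => 0 end.

Definition unrank (n : nat) : level :=
  match n with 0 => Bot | 1 => Mid | _ => Top end.

Lemma rankK : cancel rank unrank. Proof. by case. Qed.

HB.instance Definition _ := Equality.copy level (can_type rankK).

(** In [Triple l1 l2 l3 x1 x2 x3 x4 x5 x6] the strand at level [l1] joins [x1]
    to [x4], the one at level [l2] joins [x2] to [x5], and the one at level [l3]
    joins [x3] to [x6]; so the levels of the ends, read clockwise, are
    [l1 l2 l3 l1 l2 l3]. *)
Inductive site :=
  | Plain (p : piece)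
  | Triple (l1 l2 l3 : level) (x1 x2 x3 x4 x5 x6 : nat).

Coercion Plain : piece >-> site.

Definition diagram := seq piece.
Definition projection := seq site.

Definition ends (p : site) : seq nat :=
  match p with
  | Plain (Arc x y) => [:: x; y]
  | Plain (Crossing o u o' u') => [:: o; u; o'; u']
  | Triple _ _ _ x1 x2 x3 x4 x5 x6 => [:: x1; x2; x3; x4; x5; x6]
  end.

Definition labels (D : projection) : seq nat := flatten (map ends D).

Definition distinct_levels (p : site) : bool :=
  if p is Triple l1 l2 l3 _ _ _ _ _ _ then uniq [:: l1; l2; l3] else true.

Definition well_formed (D : projection) : bool :=
  all distinct_levels D &&
  all (fun x => count_mem x (labels D) == 2) (labels D).

Definition dart (D : projection) : finType :=
  {i : 'I_(size D) & 'I_(size (ends (tnth (in_tuple D) i)))}.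

Definition dart_label (D : projection) (d : dart D) : nat :=
  nth 0 (ends (tnth (in_tuple D) (tag d))) (tagged d).

Definition opposite (D : projection) (d : dart D) : dart D :=
  odflt d [pick e | (e != d) && (dart_label e == dart_label d)].

Definition clockwise (D : projection) (d : dart D) : dart D :=
  Tagged (fun i => 'I_(size (ends (tnth (in_tuple D) i)))) (ordS (tagged d)).

Definition face_step (D : projection) (d : dart D) : dart D :=
  clockwise (opposite d).

Definition adjacent (D : projection) : rel (dart D) :=
  [rel d e | (e == opposite d) || (e == clockwise d)].

(** Euler's formula [V + F = E + 2 C]; it says that every connected component has genus 0.
    The relative position of the components is immaterial to the bracket. *)
Definition planar (D : projection) : bool :=
  (size D + fcard (@face_step D) predT
   == #|dart D| ./2 + (n_comp (@adjacent D) predT).*2)%N.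

Definition link_projection (D : projection) : bool :=
  well_formed D && planar D.

(** The field of fractions of Z[A]; it contains Z[A, A^-1]. *)
Definition A : {fraction {poly int}} := tofrac 'X.

Definition delta : {fraction {poly int}} := - A ^+ 2 - A ^- 2.

Definition share (a b : nat * nat) : bool :=
  has (mem [:: b.1; b.2]) [:: a.1; a.2].

(** The number of circles formed by a crossingless diagram, i.e., its number of
    connected components. *)
Definition circles (s : seq (nat * nat)) : nat :=
  n_comp [rel i j : 'I_(size s) |
           share (tnth (in_tuple s) i) (tnth (in_tuple s) j)] predT.

(** Around [Crossing o u o' u'] the overstrand, rotated counterclockwise, sweeps
    the regions between [u'] and [o] and between [u] and [o']; joining these two
    regions leaves an arc from [o] to [u] and an arc from [o'] to [u']. *)
Definition smooth_A (o u o' u' : nat) : seq (nat * nat) :=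
  [:: (o, u); (o', u')].
Definition smooth_B (o u o' u' : nat) : seq (nat * nat) :=
  [:: (o, u'); (u, o')].

(** [s] accumulates the arcs already produced.  The value at the end is that of
    [circles s] disjoint circles.  [kauffman_circle], [kauffman_add_circle] and
    [kauffman_skein] below are the three defining rules. *)
Fixpoint kauffman_from (s : seq (nat * nat)) (D : diagram) :
    {fraction {poly int}} :=
  match D with
  | [::] => delta ^+ (circles s).-1
  | Arc x y :: D' => kauffman_from (s ++ [:: (x, y)]) D'
  | Crossing o u o' u' :: D' =>
      A * kauffman_from (s ++ smooth_A o u o' u') D' +
      A^-1 * kauffman_from (s ++ smooth_B o u o' u') D'
  end.

Definition kauffman (D : diagram) : {fraction {poly int}} :=
  kauffman_from [::] D.

Definition arcs (s : seq (nat * nat)) : diagram := [seq Arc a.1 a.2 | a <- s].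

Lemma kauffman_skein (D1 D2 : diagram) (o u o' u' : nat) :
  kauffman (D1 ++ Crossing o u o' u' :: D2) =
  A * kauffman (D1 ++ arcs (smooth_A o u o' u') ++ D2) +
  A^-1 * kauffman (D1 ++ arcs (smooth_B o u o' u') ++ D2).
Proof.
rewrite /kauffman; elim: D1 [::] => [|[x y|a b c d] D1 IH] s /=.
- by rewrite -!catA.
- exact: IH.
- by rewrite !IH !mulrDr [in LHS]addrACA !(mulrCA A^-1 A).
Qed.

Lemma share_sym : symmetric share.
Proof.
move=> [a b] [c d]; rewrite /share /= !inE !orbF.
by rewrite ![c == _]eq_sym ![d == _]eq_sym; do ![case: (_ == _)].
Qed.

Lemma circles_cons (a : nat) (s : seq (nat * nat)) :
  a \notin flatten [seq [:: b.1; b.2] | b <- s] ->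
  circles ((a, a) :: s) = (circles s).+1.
Proof.
move=> Ha; rewrite /circles /=.
set e := [rel i j | _]; set e' := [rel i j : 'I_(size s) | _].
have tS (j : 'I_(size s)) :
    tnth (in_tuple ((a, a) :: s)) (lift ord0 j) = tnth (in_tuple s) j.
  by rewrite !(tnth_nth (0, 0)%N).
have e0 j : e ord0 (lift ord0 j) = false.
  rewrite /e /= tS (tnth_nth (0, 0)%N) /share /= !inE orbF orbb.
  apply: contraNF Ha => Haj; apply/flatten_mapP.
  by exists (tnth (in_tuple s) j); [exact: mem_tnth | rewrite !inE].
have sym_e : connect_sym e.
  by apply: sym_connect_sym => i j; rewrite /e /= share_sym.
have sym_e' : connect_sym e'.
  by apply: sym_connect_sym => i j; rewrite /e' /= share_sym.
have cl0 : closed e (pred1 ord0).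
  apply: (intro_closed sym_e) => x y + /eqP ex; rewrite {x}ex.
  by case: (unliftP ord0 y) => [j ->|-> //] h; have := e0 j; rewrite [e _ _]h.
rewrite (n_compC (pred1 ord0)) -[RHS]add1n; congr (_ + _)%N.
  rewrite -(n_comp_connect sym_e ord0); apply: eq_n_comp_r => x.
  rewrite inE; apply/eqP/idP => [->|h]; first exact: connect0.
  by apply/eqP; move: (closed_connect cl0 h); rewrite !inE eqxx => <-.
have clC : closed e [predC pred1 ord0] by apply: predC_closed.
rewrite (@adjunction_n_comp _ _ (lift ord0) e e' sym_e sym_e' _ clC).
  by apply: eq_n_comp_r => j; rewrite !inE.
apply: strict_adjunction => //.
- exact: lift_inj.
- apply/subsetP => x; rewrite !inE; case: (unliftP ord0 x) => [j -> _|-> //].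
  by apply: codom_f.
- by move=> i j _; rewrite /e /e' /= !tS.
Qed.

Lemma kauffman_circle (a : nat) : kauffman [:: Arc a a] = 1.
Proof.
rewrite /kauffman /= circles_cons // /circles /n_comp_mem eq_card0 //.
by case.
Qed.

Lemma circles_gt0 (s : seq (nat * nat)) : (0 < size s)%N -> (0 < circles s)%N.
Proof.
rewrite /circles; set e := [rel i j | _] => s_gt0; apply/card_gt0P.
have sym_e : connect_sym e.
  by apply: sym_connect_sym => i j; rewrite /e /= share_sym.
exists (fingraph.root e (Ordinal s_gt0)); rewrite !inE andbT; exact: roots_root.
Qed.

Lemma kauffman_add_circle (a : nat) (D : diagram) :
  a \notin labels (map Plain D) -> (0 < size D)%N ->
  kauffman (Arc a a :: D) = delta * kauffman D.
Proof.
rewrite /kauffman /= => aD D_gt0.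
have : a \notin flatten [seq [:: b.1; b.2] | b <- [::]] by [].
have : (0 < size (Nil (nat * nat)) + size D)%N by [].
move: {D_gt0} [::] aD; elim: D => [|[x y|o u o' u'] D IH] s /=.
- rewrite addn0 => _ s_gt0 a_s; rewrite circles_cons // -exprS.
  by rewrite prednK // circles_gt0.
- rewrite /labels /= !inE !negb_or => /and3P[ax ay aD] _ a_s.
  rewrite -IH // ?size_cat ?addn1 //.
  by rewrite map_cat flatten_cat mem_cat /= !inE !negb_or a_s ax ay.
- rewrite /labels /= !inE !negb_or => /and5P[ao au ao' au' aD] _ a_s.
  rewrite mulrDr !(mulrCA delta) -!IH // ?size_cat ?addn2 //.
    by rewrite map_cat flatten_cat mem_cat /= !inE !negb_or a_s ao au ao' au'.
  by rewrite map_cat flatten_cat mem_cat /= !inE !negb_or a_s ao au ao' au'.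
Qed.

(** A double crossing with ends [x y z w] clockwise, where the strand from [x]
    to [z] is at level [l] and the strand from [y] to [w] is at level [k]. *)
Definition cross (l k : level) (x y z w : nat) : piece :=
  if (rank k < rank l)%N then Crossing x y z w else Crossing y z w x.

(** The three strands of a triple crossing moved into general position so that
    the ends [x1 x2] meet at one double crossing, [x3 x4] at another and [x5 x6]
    at the third; [a], [b], [c] are the sides of the triangle between them,
    carried by the first, second and third strand. *)
Definition triangle (l1 l2 l3 : level) (x1 x2 x3 x4 x5 x6 a b c : nat) :
    diagram :=
  [:: cross l1 l2 x1 x2 a b; cross l3 l1 x3 x4 c a; cross l2 l3 x5 x6 b c].

(** The Boolean selects one of the two generic perturbations. *)
Definition resolve (side : bool) (a b c : nat) (p : site) : diagram :=
  match p with
  | Plain q => [:: q]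
  | Triple l1 l2 l3 x1 x2 x3 x4 x5 x6 =>
      if side then triangle l2 l3 l1 x2 x3 x4 x5 x6 x1 a b c
      else triangle l1 l2 l3 x1 x2 x3 x4 x5 x6 a b c
  end.

Definition fresh (D : projection) : nat := (\max_(x <- labels D) x).+1.

Fixpoint perturb_from (side : nat -> bool) (n i : nat) (D : projection) :
    diagram :=
  if D is p :: D' then
    resolve (side i) (n + 3 * i) (n + 3 * i + 1) (n + 3 * i + 2) p
      ++ perturb_from side n i.+1 D'
  else [::].

(** [side i] is the choice of perturbation at the [i]-th site. *)
Definition perturb (side : nat -> bool) (D : projection) : diagram :=
  perturb_from side (fresh D) 0 D.

Definition bracket (side : nat -> bool) (D : projection) :
    {fraction {poly int}} :=
  kauffman (perturb side D).

Definition is_BMT (p : site) : bool :=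
  if p is Triple l1 l2 l3 _ _ _ _ _ _ then
    [:: l1; l2; l3] \in
      [:: [:: Bot; Mid; Top]; [:: Mid; Top; Bot]; [:: Top; Bot; Mid]]
  else false.

Definition is_TMB (p : site) : bool :=
  if p is Triple l1 l2 l3 _ _ _ _ _ _ then
    [:: l1; l2; l3] \in
      [:: [:: Top; Mid; Bot]; [:: Mid; Bot; Top]; [:: Bot; Top; Mid]]
  else false.

Definition straight (x1 x2 x3 x4 x5 x6 : nat) : projection :=
  [:: Plain (Arc x1 x4); Plain (Arc x2 x3); Plain (Arc x5 x6)].

Definition level_split (l : level) (p : site) : projection :=
  if p is Triple l1 l2 l3 x1 x2 x3 x4 x5 x6 then
    if l == l1 then straight x1 x2 x3 x4 x5 x6
    else if l == l2 then straight x2 x3 x4 x5 x6 x1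
    else straight x3 x4 x5 x6 x1 x2
  else [:: p].

Definition U1_split (p : site) : projection :=
  if p is Triple _ _ _ x1 x2 x3 x4 x5 x6 then
    [:: Plain (Arc x1 x2); Plain (Arc x3 x4); Plain (Arc x5 x6)]
  else [:: p].

Definition U2_split (p : site) : projection :=
  if p is Triple _ _ _ x1 x2 x3 x4 x5 x6 then
    [:: Plain (Arc x2 x3); Plain (Arc x4 x5); Plain (Arc x6 x1)]
  else [:: p].

(* Main.v *)
Require Import Defs.
From mathcomp Require Import all_boot all_order all_algebra.
From mathcomp Require Import ring zify.

(** The bracket of a projection is computed from one of its perturbations by
    resolving every double crossing.  Consider the three double crossings of one
    triple crossing.  They have eight joint smoothings.  Each of them is a
    crossingless tangle on the ends [x1 ... x6] once the sides [a], [b], [c] of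
    the small triangle are absorbed into the arcs that run through them: one
    smoothing is [U2], three are the straight-through splits, three are [U1],
    and the last is [U1] together with the triangle itself, a circle worth
    [delta].  Let [e] be [A] for a BMT crossing and [A^-1] for a TMB crossing.
    The smoothing that cuts the triangle off from the outer ends of a double
    crossing has coefficient [e] where the top and bottom strands cross and
    [e^-1] at the other two double crossings, and the opposite smoothing has the
    inverse coefficient.  So the smoothings that give [U1] add up to
    [e^-1 * delta + 2 * e + e^-3], that is, to [e], and the other coefficients
    are single powers of [e].
    This is [triangle_expansion] and [kauffman_from_triangle].

    The brackets in the relation belong to different diagrams, perturbed
    independently and with different auxiliary labels.  To compare them, apply
    the same expansion to _every_ triple crossing: [state_sum] is the resulting
    sum over crossingless diagrams.  It mentions neither the perturbation nor
    the auxiliary labels, and it equals the bracket ([bracket_state_sum]).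
    The relation is then the expansion of [state_sum] at one site
    ([state_sum_split]).  As the expansion is symmetric under rotating the
    triple crossing ([states_rotate]), both generic perturbations obey it.

    What the number of circles needs is that it depends only on the unoriented
    arcs present and that an arc may be spliced at an otherwise unused label
    ([circles_unoriented], [circles_join]); both are instances of the criterion
    [circles_corr]. *)

Import GRing.Theory.
Local Open Scope ring_scope.

(** * Counting circles *)

Definition arc_ends (s : seq (nat * nat)) : seq nat :=
  flatten [seq [:: b.1; b.2] | b <- s].

Lemma arc_ends_cat s t : arc_ends (s ++ t) = arc_ends s ++ arc_ends t.
Proof. by rewrite /arc_ends map_cat flatten_cat. Qed.

Lemma share_refl : reflexive share.
Proof. by case=> x y; rewrite /share /= !inE eqxx. Qed.

Lemma mem_arc_ends (s : seq (nat * nat)) (p : nat * nat) :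
  p \in s -> (p.1 \in arc_ends s) && (p.2 \in arc_ends s).
Proof.
by move=> sp; apply/andP; split; apply/flatten_mapP; exists p;
  rewrite // !inE eqxx ?orbT.
Qed.

(** The maps need not be inverse to each other: up to connectivity is enough,
    and then they induce inverse bijections between the components. *)
Lemma n_comp_corr (T T' : finType) (e : rel T) (e' : rel T')
    (f : T -> T') (g : T' -> T) :
  connect_sym e -> connect_sym e' ->
  (forall x y, e x y -> connect e' (f x) (f y)) ->
  (forall x y, e' x y -> connect e (g x) (g y)) ->
  (forall x, connect e x (g (f x))) -> (forall x, connect e' x (f (g x))) ->
  n_comp e predT = n_comp e' predT.
Proof.
move=> sym_e sym_e' fe ge gf fg.
have homo (S S' : finType) (r : rel S) (r' : rel S') (h : S -> S') :
    (forall x y, r x y -> connect r' (h x) (h y)) ->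
    forall x y, connect r x y -> connect r' (h x) (h y).
  move=> hr x y /connectP[p + ->]; elim: p x => //= z p IH x /andP[xz zp].
  exact: connect_trans (hr _ _ xz) (IH _ zp).
rewrite (@adjunction_n_comp _ _ g e e' sym_e sym_e' predT) //.
split=> [x _|x y _]; first by exists (f x).
apply/idP/idP; first exact: homo.
move=> /(homo _ _ _ _ _ fe) xy; apply: connect_trans (fg x) _.
by apply: connect_trans xy _; rewrite sym_e'.
Qed.

(** Splicing turns two arcs that meet at the spliced label into one, so going
    back, a shared end becomes a path through one intermediate arc. *)
Definition near (s : seq (nat * nat)) (p q : nat * nat) : bool :=
  has (fun r => share p r && share r q) s.

Lemma near_share s p q : p \in s -> share p q -> near s p q.
Proof. by move=> sp pq; apply/hasP; exists p; rewrite ?share_refl. Qed.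

(** Here [R] relates an arc of [s] to the arcs of [s'] that stand for it.  Taking
    [R] to be a relation makes the hypotheses symmetric, and since an arc shares
    ends with itself, the last hypothesis also says that two representatives of
    the same arc lie in one component. *)
Lemma circles_corr (s s' : seq (nat * nat)) (R : rel (nat * nat)) :
  {in s, forall p, exists2 p', p' \in s' & R p p'} ->
  {in s', forall p', exists2 p, p \in s & R p p'} ->
  {in s & s', forall p p', R p p' ->
   {in s & s', forall q q', R q q' ->
    (share p q -> near s' p' q') /\ (share p' q' -> near s p q)}} ->
  circles s = circles s'.
Proof.
move=> fR gR nearR; rewrite /circles.
set e := [rel i j : 'I_(size s) | _]; set e' := [rel i j : 'I_(size s') | _].
have sym_e : connect_sym e.
  by apply: sym_connect_sym => i j; rewrite /e /= share_sym.
have sym_e' : connect_sym e'.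
  by apply: sym_connect_sym => i j; rewrite /e' /= share_sym.
have near_e (t : seq (nat * nat)) (i j : 'I_(size t)) :
    near t (tnth (in_tuple t) i) (tnth (in_tuple t) j) ->
    connect [rel i j : 'I_(size t) |
             share (tnth (in_tuple t) i) (tnth (in_tuple t) j)] i j.
  case/hasP => _ /(tnthP (in_tuple t))[k ->] /andP[ik kj].
  by apply: (@connect_trans _ _ k); apply: connect1.
have /fin_all_exists[f fP] (i : 'I_(size s)) :
    exists j : 'I_(size s'), R (tnth (in_tuple s) i) (tnth (in_tuple s') j).
  have [_ /(tnthP (in_tuple s'))[j ->] ij] := fR _ (mem_tnth i (in_tuple s)).
  by exists j.
have /fin_all_exists[g gP] (j : 'I_(size s')) :
    exists i : 'I_(size s), R (tnth (in_tuple s) i) (tnth (in_tuple s') j).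
  have [_ /(tnthP (in_tuple s))[i ->] ij] := gR _ (mem_tnth j (in_tuple s')).
  by exists i.
have ms i : tnth (in_tuple s) i \in s := mem_tnth i (in_tuple s).
have ms' i : tnth (in_tuple s') i \in s' := mem_tnth i (in_tuple s').
apply: (@n_comp_corr _ _ e e' f g) => //.
- move=> i j ij; apply: near_e.
  exact: (nearR _ _ (ms i) (ms' _) (fP i) _ _ (ms j) (ms' _) (fP j)).1.
- move=> i j ij; apply: near_e.
  exact: (nearR _ _ (ms _) (ms' i) (gP i) _ _ (ms _) (ms' j) (gP j)).2.
- move=> i; apply: near_e.
  apply: (nearR _ _ (ms i) (ms' _) (fP i) _ _ (ms _) (ms' _) (gP _)).2.
  exact: share_refl.
- move=> i; apply: near_e.
  apply: (nearR _ _ (ms _) (ms' _) (gP i) _ _ (ms _) (ms' _) (fP _)).1.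
  exact: share_refl.
Qed.

Definition swap (p : nat * nat) : nat * nat := (p.2, p.1).

(** Lists with the same elements here have the same arcs up to order,
    repetition and orientation. *)
Definition unoriented (s : seq (nat * nat)) := s ++ map swap s.

Lemma swapK : involutive swap. Proof. by case. Qed.

Lemma share_swapl p q : share (swap p) q = share p q.
Proof. by rewrite /share /= !orbF orbC. Qed.
Lemma share_swapr p q : share p (swap q) = share p q.
Proof. by rewrite share_sym share_swapl share_sym. Qed.

Lemma mem_unoriented s p : (p \in unoriented s) = (p \in s) || (swap p \in s).
Proof.
by rewrite mem_cat -{2}[p]swapK (mem_map (inv_inj swapK)).
Qed.

Lemma circles_unoriented s s' :
  unoriented s =i unoriented s' -> circles s = circles s'.
Proof.
move=> ss'; pose R : rel (nat * nat) := [rel p q | (q == p) || (q == swap p)].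
apply: (@circles_corr _ _ R).
- move=> p sp; have := ss' p; rewrite !mem_unoriented sp /=.
  by case/esym/orP => h; [exists p|exists (swap p)]; rewrite // /R /= eqxx ?orbT.
- move=> p sp; have := ss' p; rewrite !mem_unoriented sp /= => /orP[] h.
    by exists p; rewrite // /R /= eqxx.
  by exists (swap p); rewrite // /R /= swapK eqxx orbT.
- move=> p p' sp sp' pp' q q' sq sq' qq'.
  have -> : share p' q' = share p q.
    by case/orP: pp' => /eqP ->; case/orP: qq' => /eqP ->;
       rewrite ?share_swapl ?share_swapr.
  split=> pq; last exact: near_share.
  apply: near_share => //.
  by case/orP: pp' => /eqP ->; case/orP: qq' => /eqP ->;
       rewrite ?share_swapl ?share_swapr.
Qed.

Lemma near_sym s : symmetric (near s).
Proof.
by move=> p q; apply: eq_has => r; rewrite andbC !(share_sym r) share_sym.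
Qed.

(** Since [a] occurs nowhere in [s], an arc of [s] meets one of the two halves
    exactly when it meets the spliced arc. *)
Lemma circles_join a x y s :
  a \notin arc_ends s ->
  circles ((x, a) :: (a, y) :: s) = circles ((x, y) :: s).
Proof.
move=> a_s; set t := [:: (x, a), _ & s]; set t' := (x, y) :: s.
have shareE q : q \in s -> share (x, y) q = share (x, a) q || share (a, y) q.
  move=> /mem_arc_ends/andP[q1 q2].
  have aN z : z \in arc_ends s -> (a == z) = false.
    by move=> zs; apply: contraNF a_s => /eqP ->.
  by rewrite /share /= !inE !aN //= !orbF.
pose R : rel (nat * nat) := [rel p q |
  (p \in s) && (q == p) || (p \in [:: (x, a); (a, y)]) && (q == (x, y))].
have new p q : p \in [:: (x, a); (a, y)] -> q \in s ->
    (share p q -> near t' (x, y) q) /\ (share (x, y) q -> near t p q).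
  move=> new_p sq; split=> [pq|].
    apply: near_share; rewrite ?mem_head // shareE //.
    by move: new_p pq; rewrite !inE => /orP[]/eqP-> ->; rewrite ?orbT.
  rewrite shareE // /near /= => /orP[] ->; move: new_p; rewrite !inE.
    by case/orP=> /eqP->; rewrite /share /= !inE !eqxx ?orbT.
  by case/orP=> /eqP->; rewrite /share /= !inE !eqxx ?orbT.
apply: (@circles_corr _ _ R).
- move=> p; rewrite !inE orbA => /orP[xap|sp].
    by exists (x, y); rewrite /R /= ?inE ?sp ?xap ?eqxx ?orbT.
  by exists p; rewrite /R /= ?inE ?sp ?xap ?eqxx ?orbT.
- move=> p; rewrite !inE => /predU1P[->|sp].
    by exists (x, a); rewrite /R /= ?inE ?sp ?xap ?eqxx ?orbT.
  by exists p; rewrite /R /= ?inE ?sp ?xap ?eqxx ?orbT.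
- move=> p p' _ _ /orP[]/andP[sp /eqP->] q q' _ _ /orP[]/andP[sq /eqP->].
  + by split=> pq; apply: near_share; rewrite // !inE sp !orbT.
  + by rewrite (share_sym p q) (share_sym p (x, y)) !(near_sym _ p); apply: new.
  + exact: new.
  + split=> _; first by rewrite /near /= share_refl.
    move: sp sq; rewrite /near /= !inE => /orP[]/eqP-> /orP[]/eqP->;
      by rewrite /share /= !inE !eqxx ?orbT.
Qed.

(** * Transfer to the bracket *)

Local Notation K := kauffman_from.

(** Resolving [D] only appends to [s] arcs whose ends are labels of [D]; so
    a change of [s] that keeps the circle count against all such arcs cannot be
    detected by [D].  Nonemptiness of [s'] keeps the circle counts positive,
    so that their predecessors also differ by [k]. *)
Lemma kauffman_from_circles k (s s' : seq (nat * nat)) (D : diagram) :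
  (0 < size s')%N ->
  (forall t, {subset arc_ends t <= labels (map Plain D)} ->
     circles (s ++ t) = (k + circles (s' ++ t))%N) ->
  K s D = delta ^+ k * K s' D.
Proof.
elim: D s s' => [|[x y|o u o' u'] D IH] s s' s'_gt0 /= ss'.
- have := ss' [::]; rewrite !cats0 => -> //.
  by rewrite -exprD -subn1 -addnBA ?subn1 // circles_gt0.
- apply: IH => [|t tD]; first by rewrite size_cat addn1.
  rewrite -!catA; apply: ss' => z; rewrite /labels /= !inE.
  by case/or3P=> [->|->|/tD]; rewrite ?orbT // => ->; rewrite !orbT.
- rewrite mulrDr !(mulrCA (delta ^+ k)).
  by congr (_ * _ + _ * _); apply: IH => [|t tD]; rewrite ?size_cat ?addn2 //;
    rewrite -!catA; apply: ss' => z; rewrite /labels /= !inE;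
    case/orP=> [->|/orP[->|/orP[->|/orP[->|/tD]]]];
    rewrite ?orbT // => ->; rewrite !orbT.
Qed.

Lemma kauffman_from_unoriented s s' D :
  unoriented s =i unoriented s' -> K s D = K s' D.
Proof.
move=> ss'; case: s' ss' => [|p s'] ss'.
  by case: s ss' => [//|p s] /(_ p); rewrite inE eqxx.
rewrite (@kauffman_from_circles 0 _ (p :: s')) ?mul1r // => t _.
apply: circles_unoriented => q; have := ss' q.
by rewrite !mem_unoriented !mem_cat !(orbACA _ (q \in t)) => ->.
Qed.

Lemma kauffman_from_join a x y s D :
  a \notin arc_ends s -> a \notin labels (map Plain D) ->
  K [:: (x, a), (a, y) & s] D = K ((x, y) :: s) D.
Proof.
move=> a_s aD; rewrite (@kauffman_from_circles 0 _ ((x, y) :: s)) ?mul1r //.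
move=> t tD; apply: circles_join; rewrite arc_ends_cat mem_cat negb_or a_s /=.
by apply: contra aD => /tD.
Qed.

Lemma kauffman_from_circle a s D :
  (0 < size s)%N -> a \notin arc_ends s -> a \notin labels (map Plain D) ->
  K ((a, a) :: s) D = delta * K s D.
Proof.
move=> s_gt0 a_s aD; rewrite (@kauffman_from_circles 1 _ s) // => t tD.
rewrite cat_cons circles_cons //; change (a \notin arc_ends (s ++ t)).
rewrite arc_ends_cat mem_cat negb_or a_s /=.
by apply: contra aD => /tD.
Qed.

(** * The eight smoothings of a triangle *)

(** The coefficient of the smoothing of [cross l k x y z w] that joins [x] to [y]
    and [z] to [w]. *)
Definition weight (l k : level) : {fraction {poly int}} :=
  if (rank k < rank l)%N then A else A^-1.

Lemma A_neq0 : A != 0.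
Proof. by rewrite /A tofrac_eq0 polyX_eq0. Qed.

Lemma swapE x y : swap (x, y) = (y, x). Proof. by []. Qed.

(** Two arc lists that are explicit up to common tails are compared arc by arc:
    membership is a disjunction of the same atoms on both sides. *)
Ltac same_arcs :=
  let p := fresh "p" in
  apply: kauffman_from_unoriented => p;
  rewrite /unoriented !(map_cat, mem_cat, map_cons, in_cons, in_nil, swapE);
  repeat match goal with
  | |- context [p == ?q] => case: (p == q); rewrite ?orbT //=
  end;
  do ?case: (p \in _) => //.

Lemma kauffman_from_cross l k x y z w s D :
  K s (cross l k x y z w :: D) =
  weight l k * K (s ++ [:: (x, y); (z, w)]) D
  + (weight l k)^-1 * K (s ++ [:: (x, w); (y, z)]) D.
Proof.
rewrite /cross /weight; case: ifP => _ //=.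
rewrite invrK addrC; congr (_ * _ + _ * _); same_arcs.
Qed.

Lemma weight_neq0 l k : weight l k != 0.
Proof. by rewrite /weight; case: ifP; rewrite ?invr_eq0 A_neq0. Qed.

(** The inequalities between the triangle sides and the other labels are
    expected among the hypotheses. *)
Ltac fresh_label :=
  rewrite /arc_ends /= !inE !negb_or;
  repeat (apply/andP; split); first [assumption | rewrite eq_sym; assumption].

(** Splices the chain at the head of [t] as long as consecutive arcs have a
    common end; [t] lists the current arcs in that order. *)
Ltac splice t :=
  match goal with |- K _ ?D = _ => transitivity (K t D) end;
  [same_arcs | repeat (rewrite kauffman_from_join; [|fresh_label|assumption])].

Fact triangle_weights (F : fieldType) (e12 e31 e23 d u1 u2 s1 s2 s3 : F) :
  e12 != 0 -> e31 != 0 -> e23 != 0 ->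
  e12 * (e31 * (e23 * (d * u1) + e23^-1 * u1) + e31^-1 * (e23 * u1 + e23^-1 * s3))
  + e12^-1 * (e31 * (e23 * u1 + e23^-1 * s2) + e31^-1 * (e23 * s1 + e23^-1 * u2))
  = (e12 * e31 * e23 * d + e12 * e31 / e23 + e12 * e23 / e31 + e31 * e23 / e12)
      * u1
    + (e12 * e31 * e23)^-1 * u2 + e23 / (e12 * e31) * s1 + e31 / (e12 * e23) * s2
    + e12 / (e31 * e23) * s3.
Proof. by move=> *; field; apply/and3P. Qed.

(** Each double crossing has two smoothings, and which tangle three of them give
    together does not depend on which strands are on top: the levels enter only
    through the weights. *)
Lemma triangle_expansion l1 l2 l3 x1 x2 x3 x4 x5 x6 a b c s D
    (e12 := weight l1 l2) (e31 := weight l3 l1) (e23 := weight l2 l3) :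
  uniq [:: a; b; c] ->
  {in [:: a; b; c], forall z, [/\ z \notin [:: x1; x2; x3; x4; x5; x6],
     z \notin arc_ends s & z \notin labels (map Plain D)]} ->
  K s (triangle l1 l2 l3 x1 x2 x3 x4 x5 x6 a b c ++ D) =
  (e12 * e31 * e23 * delta + e12 * e31 / e23 + e12 * e23 / e31 + e31 * e23 / e12)
    * K (s ++ [:: (x1, x2); (x3, x4); (x5, x6)]) D
  + (e12 * e31 * e23)^-1 * K (s ++ [:: (x2, x3); (x4, x5); (x6, x1)]) D
  + e23 / (e12 * e31) * K (s ++ [:: (x1, x4); (x2, x3); (x5, x6)]) D
  + e31 / (e12 * e23) * K (s ++ [:: (x2, x5); (x3, x4); (x6, x1)]) D
  + e12 / (e31 * e23) * K (s ++ [:: (x3, x6); (x4, x5); (x1, x2)]) D.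
Proof.
move=> abc_uniq abc_fresh.
have [a_in b_in c_in] :
    [/\ a \in [:: a; b; c], b \in [:: a; b; c] & c \in [:: a; b; c]].
  by rewrite !inE !eqxx ?orbT.
have [a_x a_s a_D] := abc_fresh a a_in.
have [b_x b_s b_D] := abc_fresh b b_in.
have [c_x c_s c_D] := abc_fresh c c_in.
have {abc_uniq}[ab ac bc] : [/\ a != b, a != c & b != c].
  by move: abc_uniq; rewrite /= !inE negb_or andbT => /andP[/andP[-> ->] ->].
move: a_x b_x c_x; rewrite !inE !negb_or.
do 3![case/and5P => ? ? ? ? /andP[? ?]].
(* One letter per double crossing, in the order of [triangle]: [P] joins [x1] to
   [x2] (resp. [x3] to [x4], [x5] to [x6]), [N] is the other smoothing. *)
have PPP : K (((s ++ [:: (x1, x2); (a, b)]) ++ [:: (x3, x4); (c, a)])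
              ++ [:: (x5, x6); (b, c)]) D
    = delta * K (s ++ [:: (x1, x2); (x3, x4); (x5, x6)]) D.
  splice [:: (a, b), (b, c), (c, a), (x1, x2), (x3, x4), (x5, x6) & s].
  by rewrite kauffman_from_circle //; [congr (_ * _); same_arcs|fresh_label].
have NPP : K (((s ++ [:: (x1, b); (x2, a)]) ++ [:: (x3, x4); (c, a)])
              ++ [:: (x5, x6); (b, c)]) D
    = K (s ++ [:: (x1, x2); (x3, x4); (x5, x6)]) D.
  splice [:: (x1, b), (b, c), (c, a), (a, x2), (x3, x4), (x5, x6) & s].
  same_arcs.
have PNP : K (((s ++ [:: (x1, x2); (a, b)]) ++ [:: (x3, a); (x4, c)])
              ++ [:: (x5, x6); (b, c)]) D
    = K (s ++ [:: (x1, x2); (x3, x4); (x5, x6)]) D.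
  splice [:: (x3, a), (a, b), (b, c), (c, x4), (x1, x2), (x5, x6) & s].
  same_arcs.
have PPN : K (((s ++ [:: (x1, x2); (a, b)]) ++ [:: (x3, x4); (c, a)])
              ++ [:: (x5, c); (x6, b)]) D
    = K (s ++ [:: (x1, x2); (x3, x4); (x5, x6)]) D.
  splice [:: (x5, c), (c, a), (a, b), (b, x6), (x1, x2), (x3, x4) & s].
  same_arcs.
have NNP : K (((s ++ [:: (x1, b); (x2, a)]) ++ [:: (x3, a); (x4, c)])
              ++ [:: (x5, x6); (b, c)]) D
    = K (s ++ [:: (x1, x4); (x2, x3); (x5, x6)]) D.
  splice [:: (x1, b), (b, c), (c, x4), (x2, a), (a, x3), (x5, x6) & s].
  splice [:: (x2, a), (a, x3), (x1, x4), (x5, x6) & s].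
  same_arcs.
have NPN : K (((s ++ [:: (x1, b); (x2, a)]) ++ [:: (x3, x4); (c, a)])
              ++ [:: (x5, c); (x6, b)]) D
    = K (s ++ [:: (x2, x5); (x3, x4); (x6, x1)]) D.
  splice [:: (x2, a), (a, c), (c, x5), (x1, b), (b, x6), (x3, x4) & s].
  splice [:: (x1, b), (b, x6), (x2, x5), (x3, x4) & s].
  same_arcs.
have PNN : K (((s ++ [:: (x1, x2); (a, b)]) ++ [:: (x3, a); (x4, c)])
              ++ [:: (x5, c); (x6, b)]) D
    = K (s ++ [:: (x3, x6); (x4, x5); (x1, x2)]) D.
  splice [:: (x3, a), (a, b), (b, x6), (x4, c), (c, x5), (x1, x2) & s].
  splice [:: (x4, c), (c, x5), (x3, x6), (x1, x2) & s].
  same_arcs.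
have NNN : K (((s ++ [:: (x1, b); (x2, a)]) ++ [:: (x3, a); (x4, c)])
              ++ [:: (x5, c); (x6, b)]) D
    = K (s ++ [:: (x2, x3); (x4, x5); (x6, x1)]) D.
  splice [:: (x1, b), (b, x6), (x2, a), (a, x3), (x4, c), (c, x5) & s].
  splice [:: (x2, a), (a, x3), (x4, c), (c, x5), (x1, x6) & s].
  splice [:: (x4, c), (c, x5), (x2, x3), (x1, x6) & s].
  same_arcs.
rewrite /triangle !cat_cons cat0s !kauffman_from_cross.
rewrite PPP NPP PNP PPN NNP NPN PNN NNN.
by apply: triangle_weights; apply: weight_neq0.
Qed.

(** * The expansion of one site *)

Definition arcs_of (D : projection) : seq (nat * nat) :=
  pmap (fun q => if q is Plain (Arc x y) then Some (x, y) else None) D.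

(** The coefficients of a triple crossing are those of the relation, for either
    orientation; a crossingless piece of strand is its own expansion. *)
Definition states (p : site) : seq ({fraction {poly int}} * seq (nat * nat)) :=
  match p with
  | Plain (Arc x y) => [:: (1, [:: (x, y)])]
  | Plain (Crossing o u o' u') =>
      [:: (A, smooth_A o u o' u'); (A^-1, smooth_B o u o' u')]
  | Triple _ _ _ _ _ _ _ _ _ =>
      let: (e, f) := if is_BMT p then (A, A^-1) else (A^-1, A) in
      [:: (e ^+ 3, arcs_of (level_split Mid p));
          (e, arcs_of (U1_split p)); (e, arcs_of (U2_split p));
          (f, arcs_of (level_split Bot p));
          (f, arcs_of (level_split Top p))]
  end.

(** The cancellation behind the relation.  The double crossing between the top
    and bottom strands has weight [e] and the other two have [f]; the strand
    that avoids it is the middle one, and its split gets [e^3].  The coefficient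
    of [u1] is [f * d + 2 * e + f ^+ 3 = e]. *)
Fact triangle_coefs (F : fieldType) (e f d u1 u2 s1 s2 s3 : F)
    (value := fun e12 e31 e23 : F =>
      (e12 * e31 * e23 * d + e12 * e31 / e23 + e12 * e23 / e31
       + e31 * e23 / e12) * u1
      + (e12 * e31 * e23)^-1 * u2 + e23 / (e12 * e31) * s1
      + e31 / (e12 * e23) * s2 + e12 / (e31 * e23) * s3)
    (formula := fun m s s' =>
      e ^+ 3 * m + e * u1 + e * u2 + f * s + f * s') :
  e != 0 -> f = e^-1 -> d = - e ^+ 2 - e ^- 2 ->
  [/\ value f f e = formula s1 s2 s3, value f e f = formula s2 s1 s3
    & value e f f = formula s3 s1 s2].
Proof.
rewrite /value /formula => e_neq0 -> ->.
by split; field; rewrite e_neq0 oner_neq0.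
Qed.

Lemma delta_inv : delta = - (A^-1) ^+ 2 - (A^-1) ^- 2.
Proof. by rewrite /delta exprVn invrK addrC. Qed.

(** In each cyclic order of the three levels, one clause of [triangle_coefs]
    applies: with [e = A] for the orders of a BMT crossing and [e = A^-1] for
    those of a TMB crossing. *)
Lemma kauffman_from_triangle l1 l2 l3 x1 x2 x3 x4 x5 x6 a b c s D :
  uniq [:: l1; l2; l3] -> uniq [:: a; b; c] ->
  {in [:: a; b; c], forall z, [/\ z \notin [:: x1; x2; x3; x4; x5; x6],
     z \notin arc_ends s & z \notin labels (map Plain D)]} ->
  K s (triangle l1 l2 l3 x1 x2 x3 x4 x5 x6 a b c ++ D) =
  \sum_(t <- states (Triple l1 l2 l3 x1 x2 x3 x4 x5 x6)) t.1 * K (s ++ t.2) D.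
Proof.
move=> l_uniq abc_uniq abc_fresh; rewrite triangle_expansion //.
have A_neq0 := A_neq0; have AV_neq0 : A^-1 != 0 by rewrite invr_eq0.
case: l1 l2 l3 l_uniq => [] [] [] //= _; rewrite !big_cons big_nil /weight /=.
all: rewrite /straight /= addr0 !addrA.
all: set u1 := K _ _; set u2 := K _ _; set s1 := K _ _; set s2 := K _ _;
  set s3 := K _ _.
all: have [C1 C2 C3] :=
  triangle_coefs _ A A^-1 delta u1 u2 s1 s2 s3 A_neq0 erefl erefl.
all: have [D1 D2 D3] :=
  triangle_coefs _ A^-1 A delta u1 u2 s1 s2 s3 AV_neq0 (esym (invrK A)) delta_inv.
all: rewrite ?(C1, C2, C3, D1, D2, D3).
(* The bottom split precedes the top one in [states], whatever their position
   among the strands. *)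
all: by [|rewrite [LHS]addrAC].
Qed.

Lemma level_split_rotate l l1 l2 l3 x1 x2 x3 x4 x5 x6 s D :
  uniq [:: l1; l2; l3] ->
  K (s ++ arcs_of (level_split l (Triple l2 l3 l1 x2 x3 x4 x5 x6 x1))) D
  = K (s ++ arcs_of (level_split l (Triple l1 l2 l3 x1 x2 x3 x4 x5 x6))) D.
Proof. by case: l l1 l2 l3 => [] [] [] [] // _; same_arcs. Qed.

(** Rotating by one end exchanges the two U-splits and permutes the strands, so
    the expansion is the same; and the second perturbation of a triple crossing
    is the first perturbation of the rotated one. *)
Lemma states_rotate l1 l2 l3 x1 x2 x3 x4 x5 x6 s D :
  uniq [:: l1; l2; l3] ->
  \sum_(t <- states (Triple l2 l3 l1 x2 x3 x4 x5 x6 x1)) t.1 * K (s ++ t.2) D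
  = \sum_(t <- states (Triple l1 l2 l3 x1 x2 x3 x4 x5 x6)) t.1 * K (s ++ t.2) D.
Proof.
move=> l_uniq; rewrite /states.
have -> : is_BMT (Triple l2 l3 l1 x2 x3 x4 x5 x6 x1) =
          is_BMT (Triple l1 l2 l3 x1 x2 x3 x4 x5 x6).
  by case: l1 l2 l3 l_uniq => [] [] [].
case: ifP => _; rewrite !big_cons big_nil /fst /snd.
all: rewrite !(level_split_rotate _ l1 l2 l3 x1 x2 x3 x4 x5 x6) //.
all: congr (_ + _).
all: rewrite [LHS]addrCA; congr (_ * _ + (_ + _)); same_arcs.
Qed.

Lemma kauffman_from_resolve side p a b c s D :
  distinct_levels p -> uniq [:: a; b; c] ->
  {in [:: a; b; c], forall z, [/\ z \notin ends p,
     z \notin arc_ends s & z \notin labels (map Plain D)]} ->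
  K s (resolve side a b c p ++ D) = \sum_(t <- states p) t.1 * K (s ++ t.2) D.
Proof.
case: p => [[x y|o u o' u']|l1 l2 l3 x1 x2 x3 x4 x5 x6] lP abc_uniq abc_fresh.
- by rewrite big_cons big_nil addr0 mul1r.
- by rewrite !big_cons big_nil addr0.
case: side; last exact: kauffman_from_triangle.
rewrite /resolve kauffman_from_triangle ?(states_rotate l1 l2 l3) //.
  by move: lP; rewrite /= !inE; case: l1 l2 l3 {abc_fresh} => [] [] [].
by move=> z /abc_fresh[]; rewrite /ends -(mem_rot 1).
Qed.

(** * The state sum *)

(** The bracket with every triple crossing expanded at once, without auxiliary
    labels. *)
Fixpoint state_sum (s : seq (nat * nat)) (D : projection) :
    {fraction {poly int}} :=
  if D is p :: D' then \sum_(t <- states p) t.1 * state_sum (s ++ t.2) D'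
  else delta ^+ (circles s).-1.

Lemma labels_perturb_from side n i D x :
  x \in labels (map Plain (perturb_from side n i D)) ->
  x \in labels D \/ (n + 3 * i <= x)%N.
Proof.
elim: D i => //= p D IH i.
rewrite /labels !map_cat flatten_cat !mem_cat => /orP[|/IH[->|]]; first 1 last.
- by rewrite orbT; left.
- by right; lia.
case: p => [[y z|o u o' u']|l1 l2 l3 x1 x2 x3 x4 x5 x6].
- by rewrite /= => ->; left.
- by rewrite /= => ->; left.
move=> xp; set a := (n + 3 * i)%N in xp *; set b := (a + 1)%N in xp *;
set c := (a + 2)%N in xp *.
have abcP (P : Prop) : x \in [:: a; b; c] -> P \/ (a <= x)%N.
  by rewrite !inE => /or3P[]/eqP ->; right; rewrite /b /c; lia.
suff h : x \in [:: x1; x2; x3; x4; x5; x6] ++ [:: a; b; c].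
  move: h; rewrite mem_cat => /orP[h|/abcP//].
  by left; rewrite [ends _]/= h.
move: xp; rewrite {abcP} /= /triangle /cross; case: (side i);
  do 3![case: ifP => _]; rewrite /= !inE; do ?[case: (x == _); rewrite ?orbT //=].
Qed.

Lemma labels_states p t x :
  t \in states p -> x \in arc_ends t.2 -> x \in ends p.
Proof.
case: p => [[y z|o u o' u']|l1 l2 l3 x1 x2 x3 x4 x5 x6] /=.
- by rewrite inE => /eqP ->.
- by rewrite !inE => /orP[]/eqP ->; rewrite /= !inE => /or4P[]->; rewrite ?orbT.
case: ifP => _; rewrite !inE => /or4P[|||/orP[]]/eqP -> /=;
  repeat case: ifP => _;
  by rewrite /= !inE; repeat (case: (x == _); rewrite ?orbT //=).
Qed.

(** The labels of the [i]-th triangle are at least [n + 3 * i], those of later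
    triangles are larger still, and all others are below [n]; so the sides of
    the triangle are fresh for the arcs accumulated so far and for everything
    that remains to be resolved. *)
Lemma kauffman_from_perturb side n i s D :
  all distinct_levels D -> {in arc_ends s ++ labels D, forall x, x < n}%N ->
  K s (perturb_from side n i D) = state_sum s D.
Proof.
elim: D s i => //= p D IH s i /andP[pP DP] small.
have fresh_n z : (n <= z)%N ->
    [/\ z \notin ends p, z \notin arc_ends s & z \notin labels D].
  move=> nz; have : z \notin arc_ends s ++ labels (p :: D).
    by apply: contraL nz => /small; rewrite -ltnNge.
  by rewrite /labels /= !mem_cat !negb_or => /and3P[].
rewrite kauffman_from_resolve //.
- apply: eq_big_seq => t tp; congr (_ * _); apply: IH => // x.
  rewrite arc_ends_cat -catA !mem_cat => xP; apply: small.
  rewrite /labels /= !mem_cat; case/or3P: xP => [->|/(labels_states _ _ _ tp)->|];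
    rewrite ?orbT // => h; by apply/orP; right; apply/orP; right.
- by rewrite /= !inE; lia.
- move=> z zabc; have [|zp zs zD] := fresh_n z.
    by move: zabc; rewrite !inE; lia.
  split=> //; apply/negP => /labels_perturb_from[]; first exact/negP.
  by move: zabc; rewrite !inE; lia.
Qed.

Lemma bracket_state_sum side D :
  all distinct_levels D -> bracket side D = state_sum [::] D.
Proof.
move=> DP; apply: kauffman_from_perturb => // x xD.
by rewrite ltnS; exact: (@leq_bigmax_seq _ _ xpredT id).
Qed.

(** The coefficients multiply and every state keeps its arcs in the order of the
    sites, so the site may be expanded before the sites that precede it. *)
Lemma state_sum_split s D1 p D2 :
  state_sum s (D1 ++ p :: D2) =
  \sum_(t <- states p) t.1 * state_sum s (D1 ++ map Plain (arcs t.2) ++ D2).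
Proof.
elim: D1 s => [|q D1 IH] s /=.
  apply: eq_bigr => t _; congr (_ * _).
  elim: t.2 s => [|[x y] r IHr] s /=; first by rewrite cats0.
  by rewrite big_cons big_nil addr0 mul1r -IHr -catA.
under eq_bigr => t _ do rewrite IH big_distrr.
rewrite exchange_big; apply: eq_bigr => t _; rewrite [RHS]big_distrr /=.
by apply: eq_bigr => r _; rewrite mulrCA.
Qed.

Theorem theorem3p1 (D1 D2 : projection) (p : site)
    (c cM cB cT cU1 cU2 : nat -> bool)
    (hD : link_projection (D1 ++ p :: D2)) :
  (is_BMT p ->
     bracket c (D1 ++ p :: D2) =
       A ^+ 3 * bracket cM (D1 ++ level_split Mid p ++ D2)
       + A * (bracket cU1 (D1 ++ U1_split p ++ D2)
              + bracket cU2 (D1 ++ U2_split p ++ D2))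
       + A^-1 * (bracket cB (D1 ++ level_split Bot p ++ D2)
                 + bracket cT (D1 ++ level_split Top p ++ D2)))
  /\
  (is_TMB p ->
     bracket c (D1 ++ p :: D2) =
       A ^- 3 * bracket cM (D1 ++ level_split Mid p ++ D2)
       + A^-1 * (bracket cU1 (D1 ++ U1_split p ++ D2)
                 + bracket cU2 (D1 ++ U2_split p ++ D2))
       + A * (bracket cB (D1 ++ level_split Bot p ++ D2)
              + bracket cT (D1 ++ level_split Top p ++ D2))).
Proof.
have [/andP[DP _] _] := andP hD.
have [D1P pP D2P] : [/\ all distinct_levels D1, distinct_levels p
    & all distinct_levels D2].
  by move: DP; rewrite all_cat /= => /and3P.
have arcsP t : all distinct_levels (D1 ++ map Plain (arcs t) ++ D2).
  by rewrite !all_cat D1P D2P !all_map andbT; apply/allP.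
case: p pP DP {hD} => [q|l1 l2 l3 x1 x2 x3 x4 x5 x6] pP DP; first by split.
set p := Triple _ _ _ _ _ _ _ _ _.
have splitE l : level_split l p = map Plain (arcs (arcs_of (level_split l p))).
  by rewrite /=; do 2?case: ifP.
have splitP l : all distinct_levels (D1 ++ level_split l p ++ D2).
  by rewrite splitE; apply: arcsP.
have U1P : all distinct_levels (D1 ++ U1_split p ++ D2).
  exact: (arcsP (arcs_of (U1_split p))).
have U2P : all distinct_levels (D1 ++ U2_split p ++ D2).
  exact: (arcsP (arcs_of (U2_split p))).
have expand e f : states p =
    [:: (e ^+ 3, arcs_of (level_split Mid p));
        (e, arcs_of (U1_split p)); (e, arcs_of (U2_split p));
        (f, arcs_of (level_split Bot p)); (f, arcs_of (level_split Top p))] ->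
  bracket c (D1 ++ p :: D2) =
    e ^+ 3 * bracket cM (D1 ++ level_split Mid p ++ D2)
    + e * (bracket cU1 (D1 ++ U1_split p ++ D2)
           + bracket cU2 (D1 ++ U2_split p ++ D2))
    + f * (bracket cB (D1 ++ level_split Bot p ++ D2)
           + bracket cT (D1 ++ level_split Top p ++ D2)).
  move=> pE; rewrite bracket_state_sum // state_sum_split pE.
  rewrite !big_cons big_nil addr0 /fst /snd -!splitE.
  by rewrite !mulrDr !addrA !bracket_state_sum.
split=> [BMT|TMB]; last rewrite -exprVn; apply: expand.
  by rewrite /states BMT.
have /negPf BMT : ~~ is_BMT p.
  by move: TMB; rewrite /p /=; case: (l1) (l2) (l3) => [] [] [].
by rewrite /states BMT.
Qed.
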